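(* Let $N\ge 3$ and $M\ge 1$ be integers. Every $N$ numbers function of $M$ variables (possibly single-valued, many-valued or no-valued at each point) can be represented as a superposition of $N$ numbers functions of one variable.
   Context: Let $A$ be a set of $N$ numbers with addition modulo $N$, i.e. $A=\mathbb{Z}/N\mathbb{Z}$ (for $N=3$, $A=\{-1,0,1\}$). An $N$ numbers function of $M$ variables assigns to each point of $A^M$ a set of values in $A$: one value (single-valued there), several values (many-valued there) or no value (no-valued there). Thus it is a map $A^M\to\mathcal{P}(A)$, where $\mathcal{P}(A)$ is the power set. Single-valued functions are identified with ordinary maps $A^M\to A$. Conventions for combining values: for $S,T\subseteq A$, $S+T=\{s+t:s\in S,\ t\in T\}$ (empty if either set is empty). For a unary function $f:A\to\mathcal{P}(A)$ and $S\subseteq A$, $f[S]=\bigcup_{s\in S}f(s)$. Sums and compositions of functions are taken pointwise with these conventions, and equality means equality of value sets at every point. Superpositions of functions of one variable, in variables $x_1,\dots,x_M$, are the functions $A^M\to\mathcal{P}(A)$ obtained by finitely many applications of the following rules: (i) $(x_1,\dots,x_M)\mapsto g(x_j)$ is a superposition for every unary $g:A\to\mathcal{P}(A)$ and every $1\le j\le M$; (ii) if $F,G$ are superpositions, so is $F+G$; (iii) if $F$ is a superposition and $f:A\to\mathcal{P}(A)$ is unary, then $f[F]$ is a superposition. For example, $\sum_{i=1}^{L}f_i\big[\sum_{j=1}^M g_{ij}(x_j)\big]$ and $f\{h[g_1(x_1)+g_2(x_2)]+g_3(x_3)\}$ are superpositions. *)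

(* Defs.v *)
From mathcomp Require Import all_boot all_order all_algebra.

Set Implicit Arguments.
Unset Strict Implicit.
Unset Printing Implicit Defensive.

Import GRing.Theory.
Local Open Scope ring_scope.

(* The N numbers with addition modulo N are 'Z_N, which in MathComp is the ring
   Z/NZ only for 1 < N.
   N numbers functions of one variable and of M variables: the value at a
   point is the (possibly empty) set of values taken there. *)
Definition unary_fun (N : nat) := 'Z_N -> {set 'Z_N}.
Definition nfun (N M : nat) := {ffun 'I_M -> 'Z_N} -> {set 'Z_N}.

Definition sumset (N : nat) (S T : {set 'Z_N}) : {set 'Z_N} :=
  [set s + t | s in S, t in T].

Definition fimage (N : nat) (f : unary_fun N) (S : {set 'Z_N}) : {set 'Z_N} :=
  \bigcup_(s in S) f s.

Inductive superposition (N M : nat) : nfun N M -> Prop :=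
| superposition_var (g : unary_fun N) (j : 'I_M) :
    superposition (fun x => g (x j))
| superposition_add (F G : nfun N M) :
    superposition F -> superposition G ->
    superposition (fun x => sumset (F x) (G x))
| superposition_comp (f : unary_fun N) (F : nfun N M) :
    superposition F -> superposition (fun x => fimage f (F x)).

(* Main.v *)
Require Import Defs.
From mathcomp Require Import all_boot all_order all_algebra.

Set Implicit Arguments.
Unset Strict Implicit.
Unset Printing Implicit Defensive.

Import GRing.Theory.

(** Since [N >= 3], the residues 0, 1, 2 are distinct, so a unary function can
    tell whether the sum of two 0/1-valued functions equals 2: conjunctions,
    hence indicators of points, are superpositions. Any function is then the
    sum over all points [p] of unary functions of the indicator of [p], sending
    0 to {0} and 1 to the value set at [p]; an empty value set makes the whole
    sum empty, as it should. *)

(** Pointwise equality replaces equality of functions, so that no functional extensionality is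
    needed. *)
Definition representable (N M : nat) (F : nfun N M) : Prop :=
  exists2 G : nfun N M, superposition G & forall x, F x = G x.

Lemma sumset11 (N : nat) (a b : 'Z_N) :
  sumset [set a] [set b] = [set (a + b)%R].
Proof. by rewrite /sumset imset2_set1l imset_set1. Qed.

Lemma sumset0l (N : nat) (S : {set 'Z_N}) : sumset [set 0%R] S = S.
Proof.
apply/setP=> a; apply/imset2P/idP => [[_ t /set1P-> tS ->]|aS].
  by rewrite add0r.
by exists 0%R a; rewrite ?set11 ?add0r.
Qed.

Lemma sumset0r (N : nat) (S : {set 'Z_N}) : sumset S [set 0%R] = S.
Proof.
apply/setP=> a; apply/imset2P/idP => [[s _ sS /set1P-> ->]|aS].
  by rewrite addr0.
by exists a 0%R; rewrite ?set11 ?addr0.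
Qed.

Lemma fimage1 (N : nat) (f : unary_fun N) (a : 'Z_N) : fimage f [set a] = f a.
Proof. exact: big_set1. Qed.

Section Representable.

Variables N M : nat.
Hypothesis N_ge3 : 3 <= N.

Implicit Types (F G : nfun N M) (b c : {ffun 'I_M -> 'Z_N} -> bool).

Lemma representable_ext F G :
  (forall x, F x = G x) -> representable F -> representable G.
Proof. by move=> eqFG [H sH eqFH]; exists H => // x; rewrite -eqFG. Qed.

Lemma representable_var (g : unary_fun N) (j : 'I_M) :
  representable (fun x => g (x j)).
Proof. by eexists; first exact: superposition_var. Qed.

Lemma representable_add F G :
  representable F -> representable G ->
  representable (fun x => sumset (F x) (G x)).
Proof.
move=> [F' sF eqF] [G' sG eqG].
by eexists; [exact: (superposition_add sF sG) | move=> x; rewrite eqF eqG].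
Qed.

Lemma representable_comp (f : unary_fun N) F :
  representable F -> representable (fun x => fimage f (F x)).
Proof.
move=> [F' sF eqF].
by eexists; [exact: (superposition_comp f sF) | move=> x; rewrite eqF].
Qed.

Definition indicator b : nfun N M := fun x => [set (b x)%:R%R].

(** As [2 < N], reduction modulo [N] fixes 0, 1 and 2. For [N = 2] the residues 0 and 2 would
    coincide. *)
Lemma eq_natr_2 (k : nat) : k <= 2 -> (k%:R%R == 2%:R%R :> 'Z_N) = (k == 2).
Proof.
move=> k_le2; have N_gt1 : 1 < N by exact: ltnW.
rewrite -(inj_eq (@ord_inj _)) !(val_Zp_nat N_gt1).
by rewrite !modn_small // (leq_ltn_trans k_le2).
Qed.

Lemma representable_and b c :
  representable (indicator b) -> representable (indicator c) ->
  representable (indicator (fun x => b x && c x)).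
Proof.
move=> rb rc.
apply: representable_ext (representable_comp
  (fun v => [set (v == 2%:R)%:R]%R) (representable_add rb rc)) => x.
rewrite /indicator sumset11 fimage1 -natrD eq_natr_2; by case: (b x); case: (c x).
Qed.

(** The empty conjunction is the constant 1. Constants arise only as constant unary functions of
    some variable, which [j0] supplies. *)
Lemma representable_all (j0 : 'I_M) (p : 'I_M -> 'Z_N) (s : seq 'I_M) :
  representable (indicator (fun x => all (fun j => x j == p j) s)).
Proof.
elim: s => [|j s IHs]; first exact: (representable_var (fun=> [set 1%R]) j0).
apply: representable_and IHs.
exact: (representable_var (fun a => [set (a == p j)%:R%R])).
Qed.

Lemma representable_point (j0 : 'I_M) (p : {ffun 'I_M -> 'Z_N}) :
  representable (indicator (fun x => x == p)).
Proof.
apply: representable_ext (representable_all j0 p (enum 'I_M)) => x.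
congr [set (nat_of_bool _)%:R%R]; apply/allP/eqP => [eqxp|-> //].
by apply/ffunP=> j; apply/eqP/eqxp/mem_enum.
Qed.

(** Off the list the value is [{0}], neutral for [sumset]. Each point must be listed once, since
    [F p + F p] may differ from [F p]. *)
Lemma representable_on_seq (j0 : 'I_M) F (r : seq {ffun 'I_M -> 'Z_N}) :
  uniq r -> representable (fun x => if x \in r then F x else [set 0%R]).
Proof.
elim: r => [_|p r IHr /= /andP[p_notin /IHr{}IHr]].
  exact: (representable_var (fun=> [set 0%R]) j0).
(* The new term contributes [F p] at [p], where the tail gives [{0}] because [p] is not in [r], and
   [{0}] elsewhere. *)
pose h : unary_fun N := fun v => if v == 0%R then [set 0%R] else F p.
apply: representable_ext (representable_add
  (representable_comp h (representable_point j0 p)) IHr) => x.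
rewrite fimage1 /h inE; have [->|_] := eqVneq x p.
  by rewrite (negPf p_notin) oner_eq0 sumset0r.
by rewrite eqxx sumset0l.
Qed.

End Representable.

Theorem theorem2p2 (N M : nat) (hN : 3 <= N) (hM : 1 <= M) (F : nfun N M) :
  exists2 G : nfun N M, superposition G & forall x, F x = G x.
Proof.
apply: representable_ext (representable_on_seq hN (Ordinal hM) F
  (enum_uniq {ffun 'I_M -> 'Z_N})) => x.
by rewrite mem_enum.
Qed.
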